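(* Let $S$ be a subcartesian space. For every $x\in S$ and every derivation $X\in\mathrm{Der}(C^{\infty}(S))$ there exists a unique maximal integral curve $c:I\to S$ of $X$ through $x$.
   Context: A differential structure on a topological space $R$ is a family $C^{\infty}(R)$ of functions $R\to\mathbb{R}$ such that: (i) the sets $f^{-1}((a,b))$, $f\in C^{\infty}(R)$, $a,b\in\mathbb{R}$, form a sub-basis for the topology of $R$; (ii) if $f_1,\dots,f_n\in C^{\infty}(R)$ and $F\in C^{\infty}(\mathbb{R}^n)$ then $F(f_1,\dots,f_n)\in C^{\infty}(R)$; (iii) if $f:R\to\mathbb{R}$ is such that every $x\in R$ has an open neighbourhood $U_x$ and a function $f_x\in C^{\infty}(R)$ with $f|U_x=f_x|U_x$, then $f\in C^{\infty}(R)$. A differential space is a topological space with a differential structure. A continuous map $\varphi:S\to R$ is smooth if $f\circ\varphi\in C^{\infty}(S)$ for all $f\in C^{\infty}(R)$; a homeomorphism $\varphi$ is a diffeomorphism if $\varphi,\varphi^{-1}$ are smooth. A subset $S\subseteq R$ with the subspace topology is a differential subspace with $f\in C^{\infty}(S)$ iff each $x\in S$ has an open neighbourhood $U$ in $R$ and $f_x\in C^{\infty}(R)$ with $f|(S\cap U)=f_x|(S\cap U)$. A subcartesian space is a Hausdorff differential space covered by open sets each of which is diffeomorphic to a differential subspace of some $\mathbb{R}^n$. Standing assumption: all differential spaces are Hausdorff, second countable and paracompact. $\mathrm{Der}(C^{\infty}(S))$ is the space of derivations, i.e. linear maps $X:C^{\infty}(S)\to C^{\infty}(S)$, $f\mapsto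 X\cdot f$, satisfying Leibniz' rule. An integral curve of $X$ through $x$ is a smooth curve $c:I\to S$, where $I\subseteq\mathbb{R}$ is an interval containing $0$, with $c(0)=x$ and $\frac{d}{dt}f(c(t))=(X\cdot f)(c(t))$ for all $f\in C^{\infty}(S)$ and $t\in I$. The interval $I$ need not be open (one-sided derivatives are used at endpoints) and may reduce to the single point $\{0\}$, in which case the differential condition is vacuous. Maximal means that $c$ is not a proper restriction of another integral curve of $X$ through $x$. *)

(* Defs.v *)
(* An arbitrary [R : realType] plays the role of the real line. *)
From mathcomp Require Import all_boot all_order all_algebra.
From mathcomp Require Import all_classical all_reals all_analysis.

Set Implicit Arguments.
Unset Strict Implicit.
Unset Printing Implicit Defensive.

Import Order.TTheory GRing.Theory Num.Theory numFieldNormedType.Exports.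

Local Open Scope classical_set_scope.
Local Open Scope ring_scope.

Section SmoothFunctions.
Context {R : realType} {V : normedModType R}.

Fixpoint Ck (k : nat) (f : V -> R^o) : Prop :=
  if k is k'.+1 then
    (forall x, differentiable f x) /\ (forall v, Ck k' ('D_v f))
  else continuous f.

(* The family C^oo(V); it is only used for V = 'rV[R]_n and V = R^o. *)
Definition Cinfty : set (V -> R) := [set f | forall k, Ck k f].

End SmoothFunctions.
Arguments Cinfty {R} V.

Section Topology.
Context {T : topologicalType}.

Definition subbasis (B : set (set T)) : Prop := basis (finI_from B id).

Definition open_cover (U : set (set T)) : Prop :=
  U `<=` open /\ \bigcup_(A in U) A = [set: T].

Definition refines (W U : set (set T)) : Prop :=
  forall B, W B -> exists2 A, U A & B `<=` A.

Definition locally_finite (W : set (set T)) : Prop :=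
  forall x : T, exists2 N, nbhs x N & finite_set [set B | W B /\ B `&` N !=set0].

End Topology.

Definition paracompact (T : topologicalType) : Prop :=
  forall U : set (set T), open_cover U ->
    exists W, [/\ open_cover W, refines W U & locally_finite W].

Section DifferentialSpaces.
Context {R : realType}.

Record differential_structure (T : topologicalType) (C : set (T -> R)) : Prop := {
  ds_subbasis :
    subbasis [set A | exists f (a b : R), C f /\ A = f @^-1` `]a, b[%classic];
  ds_comp : forall n (f : 'I_n -> T -> R) (F : 'rV[R]_n -> R),
    (forall i, C (f i)) -> Cinfty 'rV[R]_n F ->
    C (fun x => F (\row_i f i x));
  ds_local : forall f : T -> R,
    (forall x, exists U g, [/\ open_nbhs x U, C g & {in U, f =1 g}]) -> C f }.

Record differential_space (T : topologicalType) (C : set (T -> R)) : Prop := {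
  dsp_structure : differential_structure C;
  dsp_hausdorff : hausdorff_space T;
  dsp_second_countable : @second_countable T;
  dsp_paracompact : paracompact T }.

Definition smooth_map (T T' : topologicalType)
    (C : set (T -> R)) (C' : set (T' -> R)) (phi : T -> T') : Prop :=
  continuous phi /\ (forall f, C' f -> C (f \o phi)).

Definition diffeomorphic (T T' : topologicalType)
    (C : set (T -> R)) (C' : set (T' -> R)) : Prop :=
  exists (phi : T -> T') (psi : T' -> T),
    [/\ cancel phi psi, cancel psi phi,
        smooth_map C C' phi & smooth_map C' C psi].

(* The subset A, as a type, carries the subspace topology (see
   subtype_topology.v). *)
Definition subspace_structure (T : topologicalType) (C : set (T -> R))
    (A : set T) : set (A -> R) :=
  [set f | forall x : A, exists U g,
     [/\ open_nbhs (\val x) U, C g &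
         forall y : A, U (\val y) -> f y = g (\val y)]].
Arguments subspace_structure {T} C A.

Definition euclidean_chart_domain (T : topologicalType) (C : set (T -> R))
    (U : set T) : Prop :=
  exists n (A : set 'rV[R]_n),
    diffeomorphic (subspace_structure C U)
                  (subspace_structure (Cinfty 'rV[R]_n) A).

Definition subcartesian (T : topologicalType) (C : set (T -> R)) : Prop :=
  differential_space C /\
  exists2 U : set (set T), open_cover U & U `<=` euclidean_chart_domain C.

(* Der(C): the values of X outside C are junk and never used. *)
Record derivation (T : topologicalType) (C : set (T -> R))
    (X : (T -> R) -> (T -> R)) : Prop := {
  der_stable : forall f, C f -> C (X f);
  der_linear : forall (a : R) f g, C f -> C g ->
    forall x, X (fun y => a * f y + g y) x = a * X f x + X g x;
  der_leibniz : forall f g, C f -> C g ->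
    forall x, X (fun y => f y * g y) x = X f x * g x + f x * X g x }.

Record curve (T : topologicalType) := Curve {
  dom : set R;
  curve_fun :> dom -> T }.

(* The derivative at t is a limit along the punctured neighbourhoods of t in
   dom c: it is one-sided at the endpoints of dom c, and the condition is
   vacuous when dom c is a single point. *)
Record integral_curve (T : topologicalType) (C : set (T -> R))
    (X : (T -> R) -> (T -> R)) (x : T) (c : curve T) : Prop := {
  ic_interval : is_interval (dom c);
  ic_zero : dom c 0;
  ic_smooth : smooth_map (subspace_structure (Cinfty R^o) (dom c)) C c;
  ic_start : forall t : dom c, \val t = 0 -> c t = x;
  ic_deriv : forall f, C f -> forall t : dom c,
    (f (c s) - f (c t)) / (\val s - \val t) @[s --> t^'] --> X f (c t) }.

Definition proper_restriction (T : topologicalType) (c d : curve T) : Prop :=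
  dom c `<` dom d /\
  (forall (s : dom c) (t : dom d), \val s = \val t -> c s = d t).

Definition maximal_integral_curve (T : topologicalType) (C : set (T -> R))
    (X : (T -> R) -> (T -> R)) (x : T) (c : curve T) : Prop :=
  integral_curve C X x c /\
  ~ (exists2 d, integral_curve C X x d & proper_restriction c d).

End DifferentialSpaces.
Arguments curve : clear implicits.

(* Main.v *)
Require Import Defs.
From mathcomp Require Import all_boot all_order all_algebra.
From mathcomp Require Import all_classical all_reals all_analysis.
From mathcomp Require Import ring lra.

(** Every function f of the differential structure turns an integral curve c of
    X into a real function f o c that is locally the restriction of a smooth
    function and whose derivative is (X f) o c.  Two facts follow.

    Integral curves through x agree wherever they are both defined
    ([trajectory_unique]).  Near a point y, a chart gives functions q_1, ...,
    q_n of the structure that separate points and through which every function of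
    the structure factors smoothly ([chart_coordinates]); in particular
    X q_i = G_i(q_1, ..., q_n) near y with G_i smooth on the whole of R^n.  So
    the coordinates of an integral curve solve the differential equation
    u' = G(u), whose solutions are unique because G is locally Lipschitz
    ([ode_unique]).  Hence the set where two integral curves agree is open in
    the intersection of their domains; it is closed because S is Hausdorff, and
    an interval is connected.

    The union of all integral curves through x is an integral curve
    ([trajectory_bigcup]).  The point to check is smoothness at a time t that
    one curve only reaches from the left and another only from the right.  No
    flow is constructed in R^n: near t, f o c is g1 before t and g2 after t, for
    two smooth functions whose k-th derivatives at t both equal (X^k f)(c t),
    and smooth functions with the same jet at t can be spliced ([Ck_splice]).
    Existence of a solution of the differential equation is never at stake,
    since the constant curve on {0} is an integral curve.

    The union extends every integral curve through x, so it is maximal and any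
    other maximal one is equal to it.

    The argument is carried out for total functions on R restricted to a set D
    ([trajectory]), and transported to and from curves on the subtype D. *)

Set Implicit Arguments.
Unset Strict Implicit.
Unset Printing Implicit Defensive.

Import Order.TTheory GRing.Theory Num.Theory numFieldNormedType.Exports.

Local Open Scope ring_scope.
Local Open Scope classical_set_scope.

(** * Smooth functions *)

Section SmoothFunctionTheory.
Context {R : realType} {V : normedModType R}.
Implicit Types f : V -> R.

Lemma Cinfty_differentiable f x : Cinfty V f -> differentiable (f : V -> R^o) x.
Proof. by move=> Cf; have [+ _] := Cf 1%N; apply. Qed.

Lemma Cinfty_derive f v : Cinfty V f -> Cinfty V ('D_v (f : V -> R^o)).
Proof. by move=> Cf k; have [_] := Cf k.+1; apply. Qed.

Lemma Cinfty_continuous f : Cinfty V f -> continuous f.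
Proof. by move=> Cf; exact: (Cf 0%N). Qed.

Lemma Ck_cst k (a : R) : Ck k (fun _ : V => a : R^o).
Proof.
elim: k a => [|k IH] a /=; first exact: cst_continuous.
split=> [x|v]; first exact: differentiable_cst.
rewrite (_ : 'D_v _ = fun _ => 0)//.
by apply/funext => x; exact: derive_cst.
Qed.

Lemma Ck_scale k (a : R) (f : V -> R^o) : Ck k f -> Ck k (a *: f).
Proof.
elim: k f => [|k IH] f /=.
  by move=> cf x; apply: continuousZl_tmp => //; exact: cf.
move=> [df Df]; split=> [x|v]; first exact: differentiableZ.
rewrite (_ : 'D_v _ = a *: 'D_v f); first exact: IH.
by apply/funext => x; rewrite deriveZ//; exact: diff_derivable.
Qed.

End SmoothFunctionTheory.

Lemma Cinfty_coord (R : realType) n (i : 'I_n) :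
  Cinfty 'rV[R]_n (fun r => r 0 i).
Proof.
case=> [|k] /=; first exact: coord_continuous.
have D x : differentiable (fun r : 'rV[R]_n => r 0 i : R^o) x.
  exact: differentiable_coord.
split=> // v; rewrite (_ : 'D_v _ = fun _ => v 0 i); first exact: Ck_cst.
apply/funext => x.
have := derive_mx (@derivable_id R _ x v); rewrite derive_id.
by move=> /matrixP/(_ 0 i); rewrite mxE.
Qed.

Section RealLine.
Context {R : realType}.
Implicit Types (g : R -> R) (t l : R).

(** The form without quotients makes sense at s = t, so it survives replacing
    the neighbourhood of t by a piece of an interval, and it can be checked
    separately on each side of t. *)
Lemma is_derive1P g t l : is_derive t 1 (g : R -> R^o) l <->
  forall e, 0 < e ->
    \forall s \near t, `|g s - g t - (s - t) * l| <= e * `|s - t|.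
Proof.
split=> [[dg dl] e e0|H].
  have L : h^-1 *: ((g \o shift t) (h *: 1) - g t) @[h --> 0^'] --> (l : R^o).
    by rewrite -dl; exact: dg.
  move/cvgrPdist_le : L => /(_ e e0)/nbhs_ballP[d /= d0 dH].
  apply/nbhs_ballP; exists d => //= s ts.
  have [->|st] := eqVneq s t; first by rewrite !subrr mul0r subrr normr0 mulr0.
  have st0 : s - t != 0 by rewrite subr_eq0.
  have := dH (s - t); rewrite /ball/= sub0r normrN.
  rewrite -[`|s - t|]distrC => /(_ ts st0).
  rewrite /= [_%:A]mulr1 subrK => /(ler_wpM2l (normr_ge0 (s - t))).
  rewrite -normrM mulrBr /= [_ *: _]/(_ * _) mulVKf// [leLHS]distrC => P.
  by rewrite [`|t - s|]distrC [leRHS]mulrC.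
suff L : h^-1 *: ((g \o shift t) (h *: 1) - g t) @[h --> 0^'] --> (l : R^o).
  by split; [apply/cvg_ex; exists l | exact/cvg_lim].
apply/cvgrPdist_le => e e0; move: (H e e0) => /nbhs_ballP[d /= d0 dH].
apply/nbhs_ballP; exists d => //= h; rewrite /ball/= sub0r normrN => hd h0.
rewrite [_%:A]mulr1 [_ *: _]/(_ * _).
have := dH (h + t); rewrite /ball/= opprD addrCA subrr addr0 normrN => /(_ hd).
rewrite addrK => K; rewrite -(ler_pM2l (_ : 0 < `|h|)) ?normr_gt0//.
by rewrite -normrM mulrBr mulVKf// [leLHS]distrC [leRHS]mulrC.
Qed.

Definition splice t g1 g2 s := if s <= t then g1 s else g2 s.

Lemma is_derive_splice t g1 g2 (d1 d2 : R -> R) (s : R) :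
  (forall r : R, is_derive r 1 (g1 : R -> R^o) (d1 r)) ->
  (forall r : R, is_derive r 1 (g2 : R -> R^o) (d2 r)) ->
  g1 t = g2 t -> d1 t = d2 t ->
  is_derive s 1 (splice t g1 g2 : R -> R^o) (splice t d1 d2 s).
Proof.
move=> dg1 dg2 g12 d12; apply/is_derive1P => e e0.
have /is_derive1P/(_ e e0) H1 := dg1 s.
have /is_derive1P/(_ e e0) H2 := dg2 s.
rewrite /splice; have [st|ts|st] := ltgtP s t.
- near=> r; have -> : r <= t by near: r; exact: lt_le_nbhsl.
  by near: r.
- near=> r; rewrite (leNgt r t); have -> /= : t < r by near: r; exact: lt_nbhsr.
  by near: r.
- near=> r; case: (leP r t) => _; first by near: r.
  by rewrite st g12 d12 -st; near: r.
Unshelve. all: by end_near. Qed.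

Lemma Cinfty_derive1n g k : Cinfty R^o g -> Cinfty R^o g^`(k).
Proof.
elim: k => [|k IH] // /IH Cg; rewrite derive1nS.
rewrite (_ : _^`() = 'D_1 (g^`(k) : R^o -> R^o)); first exact: Cinfty_derive.
by apply/funext => s; rewrite derive1E.
Qed.

Lemma Cinfty_is_derive g (s : R) :
  Cinfty R^o g -> is_derive s 1 (g : R -> R^o) (g^`() s).
Proof.
move=> Cg; rewrite derive1E; apply: derivableP; apply: diff_derivable.
exact: Cinfty_differentiable.
Qed.

(** The derivative of a splice is the splice of the derivatives, and these have
    the same jet at t again: this is what makes the induction go through. *)
Lemma Ck_splice k t g1 g2 : Cinfty R^o g1 -> Cinfty R^o g2 ->
  (forall k, g1^`(k) t = g2^`(k) t) -> Ck k (splice t g1 g2 : R^o -> R^o).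
Proof.
elim: k g1 g2 => [|k IH] g1 g2 C1 C2 g12.
all: have D (s : R) :
  is_derive s 1 (splice t g1 g2 : R -> R^o) (splice t g1^`() g2^`() s).
all: try by apply: is_derive_splice;
  [move=> r; exact: Cinfty_is_derive..|exact: (g12 0%N)|exact: (g12 1%N)].
all: have df s : differentiable (splice t g1 g2 : R^o -> R^o) s
  by apply/derivable1_diffP; case: (D s).
  by move=> s; apply: differentiable_continuous.
split=> // v; rewrite (_ : 'D_v _ = v *: (splice t g1^`() g2^`() : R^o -> R^o)).
  apply: Ck_scale; apply: IH.
  - exact: (@Cinfty_derive1n _ 1%N).
  - exact: (@Cinfty_derive1n _ 1%N).
  - by move=> j; rewrite -!derive1Sn.
apply/funext => s; rewrite deriveE// -[v in LHS]mulr1 linearZ/= -deriveE//.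
by have [_ ->] := D s.
Qed.

End RealLine.

(** * Ordinary differential equations *)

Section OrdinaryDifferentialEquations.
Context {R : realType}.

Lemma cvg_row (T : Type) (F : set_system T) (FF : Filter F) n
    (f : 'I_n -> T -> R) (l : 'I_n -> R) :
  (forall i, f i x @[x --> F] --> l i) ->
  (\row_i f i x : 'rV[R]_n) @[x --> F] --> (\row_i l i : 'rV[R]_n).
Proof.
move=> fl; apply/cvgrPdist_le => /= e e0; near=> x.
rewrite /Num.Def.normr/= mx_normrE (bigmax_le _ (ltW e0))//= => -[i j] _.
rewrite !mxE/=; move: j; near: x; apply: filter_forall => j.
by move/cvgrPdist_le : (fl j); apply.
Unshelve. all: by end_near. Qed.

Lemma le_rV_norm n (r : 'rV[R]_n) i : `|r 0 i| <= `|r|.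
Proof.
by rewrite [leRHS]/Num.Def.normr/= mx_normrE; exact: (le_bigmax _ _ (0, i)).
Qed.

Lemma rV_norm_le n (r : 'rV[R]_n) e :
  0 <= e -> (forall i, `|r 0 i| <= e) -> `|r| <= e.
Proof.
move=> e0 re; rewrite /Num.Def.normr/= mx_normrE (bigmax_le _ e0)//=.
by move=> -[i j] _ /=; rewrite (ord1 i).
Qed.

Lemma mean_value_bound (f df : R -> R) (x y B : R) :
  (forall r : R, is_derive r 1 (f : R -> R^o) (df r)) ->
  (forall r, Num.min x y <= r <= Num.max x y -> `|df r| <= B) ->
  `|f x - f y| <= B * `|x - y|.
Proof.
move=> fdf; wlog xy : x y / x <= y => [W dfB|].
  case/orP: (le_total x y) => [/W|yx]; first exact.
  by rewrite distrC (distrC x); apply: W => // r; rewrite minC maxC; exact: dfB.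
rewrite min_l// max_r// => dfB.
have cf : {within `[x, y], continuous f}.
  apply: continuous_subspaceT => r; apply: differentiable_continuous.
  by apply/derivable1_diffP; case: (fdf r).
have [c cxy E] := MVT_segment xy (fun r _ => fdf r) cf.
rewrite distrC E normrM (distrC x) ler_wpM2r// dfB// -in_itv/=.
Qed.

(** The partial derivatives are continuous, hence bounded on a ball around p;
    as a ball is convex, the mean value theorem applies along the segment from
    b to a. *)
Lemma Cinfty_locally_lipschitz n (G : 'rV[R]_n -> R) (p : 'rV[R]_n) :
  Cinfty 'rV[R]_n G ->
  exists L, \forall a \near p & b \near p, `|G a - G b| <= L * `|a - b|.
Proof.
move=> CG; pose D (j : 'I_n) := 'D_(delta_mx 0 j) (G : _ -> R^o).
pose L := \sum_(j < n) (`|D j p| + 1); exists L.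
have : \forall z \near p, forall j : 'I_n, `|D j z| <= `|D j p| + 1.
  have FF : Filter (nbhs p) by exact: nbhs_filter.
  apply: (@filter_forall _ 'I_n _ _ FF) => j.
  have /cvgrPdist_le/(_ 1 ltr01) : D j z @[z --> p] --> D j p.
    exact/Cinfty_continuous/Cinfty_derive.
  apply: filterS => z; rewrite distrC => Dz.
  rewrite -lerBlDl (le_trans _ Dz)// (le_trans (lerB_dist _ _))//.
move=> /nbhs_ballP[r /= r0 DL].
have pr : nbhs p (ball p r) by exact: nbhsx_ballx.
exists (ball p r, ball p r) => // -[a b] /= [pa pb].
pose pt (s : R) := b + s *: (a - b).
pose h (s : R) := G (pt s).
pose dh (s : R) := 'D_(a - b) (G : _ -> R^o) (pt s).
have hdh (s : R) : is_derive s 1 (h : R -> R^o) (dh s).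
  have : is_derive (pt s) (a - b) (G : _ -> R^o) (dh s).
    by apply: derivableP; apply: diff_derivable; exact: Cinfty_differentiable.
  case=> d1 d2.
  (* both directional derivatives are limits of the same quotient *)
  suff E : (fun e : R => e^-1 *: ((h \o shift s) (e *: 1) - h s : R^o)) =
      (fun e : R => e^-1 *: (((G : _ -> R^o) \o shift (pt s)) (e *: (a - b))
        - G (pt s))).
    by split; [rewrite /derivable E | rewrite /derive E].
  apply/funext => e; rewrite /h /pt /= [_%:A]mulr1 scalerDl.
  by rewrite addrCA.
have : `|h 1 - h 0| <= L * `|a - b| * `|1 - 0|.
  apply: (mean_value_bound hdh) => s; rewrite min_r// max_l// => /andP[s0 s1].
  rewrite /dh; set z := pt s; have pz : ball p r z.
    move: pa pb; rewrite -ball_normE /ball_/= => pa pb.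
    have -> : p - z = (1 - s) *: (p - b) + s *: (p - a).
      by rewrite /z /pt; apply/rowP => j; rewrite !mxE; ring.
    apply: le_lt_trans (ler_normD _ _) _.
    rewrite !normrZ !ger0_norm ?subr_ge0//.
    have [->|s1'] := eqVneq s 1; first by rewrite subrr mul0r mul1r add0r.
    have s1'' : 0 < 1 - s by rewrite subr_gt0 lt_neqAle s1' s1.
    rewrite (_ : r = (1 - s) * r + s * r); last by ring.
    by rewrite ltr_leD// ?ltr_pM2l// ler_wpM2l// ltW.
  rewrite deriveE; last exact: Cinfty_differentiable.
  rewrite [X in 'd _ _ X](row_sum_delta (a - b)) linear_sum mulr_suml.
  apply: le_trans (ler_norm_sum _ _ _) _; apply: ler_sum => j _.
  rewrite linearZ/= normrM mulrC ler_pM// ?le_rV_norm//.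
  by rewrite -deriveE; [exact: DL|exact: Cinfty_differentiable].
rewrite /h /pt subr0 normr1 mulr1 scale1r scale0r addr0.
by have -> : b + (a - b) = a by rewrite addrC subrK.
Qed.

(** Near t the field is Lipschitz with some constant M.  On a segment J from t
    to a nearby time, of length at most 1 / (2 (M + 1)), let W be the distance
    between the two solutions: the mean value theorem bounds its maximum by
    M |J| max W <= max W / 2, so W vanishes on J.  Both functions are defined on
    the whole line, but solve the equation only on the interval K, of which t
    may be an endpoint. *)
Lemma ode_unique n (G : 'I_n -> 'rV[R]_n -> R) (u v : 'I_n -> R -> R)
    (K : set R) t :
  (forall i, Cinfty 'rV[R]_n (G i)) ->
  (forall i (s : R), is_derive s 1 (u i : R -> R^o) (derive1 (u i) s)) ->
  (forall i (s : R), is_derive s 1 (v i : R -> R^o) (derive1 (v i) s)) ->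
  is_interval K -> K t ->
  (\forall s \near t, K s -> forall i, derive1 (u i) s = G i (\row_j u j s)) ->
  (\forall s \near t, K s -> forall i, derive1 (v i) s = G i (\row_j v j s)) ->
  (forall i, u i t = v i t) ->
  \forall s \near t, K s -> forall i, u i s = v i s.
Proof.
move=> CG du dv itvK Kt odeu odev uvt.
have /choice[L HL] : forall i, exists L,
    \forall a \near (\row_j u j t : 'rV[R]_n) &
            b \near (\row_j u j t : 'rV[R]_n), `|G i a - G i b| <= L * `|a - b|.
  by move=> i; exact: Cinfty_locally_lipschitz.
pose M := \sum_i `|L i|.
have cU : continuous (fun s : R => \row_j u j s : 'rV[R]_n).
  move=> s; apply: cvg_row => i; apply: differentiable_continuous.
  by apply/derivable1_diffP; case: (du i s).
have cV : continuous (fun s : R => \row_j v j s : 'rV[R]_n).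
  move=> s; apply: cvg_row => i; apply: differentiable_continuous.
  by apply/derivable1_diffP; case: (dv i s).
have UVt : \row_j v j t = \row_j u j t by apply/rowP => i; rewrite !mxE uvt.
have lip : \forall s \near t, forall i, K s ->
    `|derive1 (u i) s - derive1 (v i) s| <= M * `|\row_j u j s - \row_j v j s|.
  have FF : Filter (nbhs t) by exact: nbhs_filter.
  apply: (@filter_forall _ 'I_n _ _ FF) => i; near=> s => Ks.
  have -> : derive1 (u i) s = G i (\row_j u j s) by rewrite (near odeu s).
  have -> : derive1 (v i) s = G i (\row_j v j s) by rewrite (near odev s).
  have : `|L i| <= M by rewrite /M (bigD1 i)//= lerDl sumr_ge0.
  move=> LM; apply: (@le_trans _ _ (L i * `|\row_j u j s - \row_j v j s|)).
    near: s; have [[A B] /= [nA nB] AB] := HL i.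
    near=> s; apply: (AB (_, _)); split => /=; near: s; first exact: cU.
    by apply: cV; rewrite UVt.
  by rewrite ler_wpM2r// (le_trans (ler_norm _)).
have M0 : 0 <= M by rewrite sumr_ge0.
move: lip => /nbhs_ballP[d /= d0 dM].
have e0 : 0 < Num.min d (M + 1)^-1 / 2.
  by rewrite divr_gt0// lt_min d0 invr_gt0 ltr_wpDl.
apply/nbhs_ballP; exists (Num.min d (M + 1)^-1 / 2) => // s ts Ks.
have ed : Num.min d (M + 1)^-1 / 2 <= d.
  have : Num.min d (M + 1)^-1 <= d by rewrite ge_min lexx.
  by move: d0 => /=; lra.
pose W (r : R) : R := `|\row_j u j r - \row_j v j r : 'rV[R]_n|.
have cW : continuous W.
  by move=> r; apply: cvg_norm; apply: cvgB; [exact: cU|exact: cV].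
have ab : Num.min s t <= Num.max s t by rewrite ge_min le_max lexx.
have [m] := EVT_max ab (continuous_subspaceT cW).
rewrite in_itv/= => mab mmax.
have sW : W s <= W m by apply: mmax; rewrite in_itv/= ge_min le_max lexx.
have sub r : Num.min s t <= r <= Num.max s t -> K r /\ `|t - r| <= `|t - s|.
  move=> rst; case: (leP s t) rst => [st|/ltW ts'] /andP[r1 r2]; split.
  - by apply: (itvK s t) => //; rewrite r1.
  - by rewrite !ger0_norm ?subr_ge0// lerD2l lerN2.
  - by apply: (itvK t s) => //; rewrite r1.
  - by rewrite distrC (distrC t s) !ger0_norm ?subr_ge0// lerD2r.
have Wm : W m <= W m / 2.
  apply: rV_norm_le; first by rewrite divr_ge0// normr_ge0.
  move=> i; rewrite !mxE.
  have hw (r : R) : is_derive r 1 (u i - v i : R -> R^o)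
      (derive1 (u i) r - derive1 (v i) r).
    exact: is_deriveB.
  have /(_ _)/le_trans := @mean_value_bound _ _ m t (M * W m) hw.
  rewrite !fctE uvt subrr subr0; apply.
    move=> r rmt.
    have rst : Num.min s t <= r <= Num.max s t.
      move: rmt mab; rewrite !(ge_min, le_max).
      by case: (leP s t); case: (leP m t); lra.
    have [Kr rs] := sub _ rst.
    apply: le_trans (dM r _ _ Kr) _.
      by apply: le_lt_trans rs _; exact: lt_le_trans ts ed.
    by apply: ler_wpM2l => //; apply: mmax; rewrite in_itv/=.
  have [_ mt] := sub _ mab.
  rewrite -mulrA mulrCA; apply: ler_wpM2l; first exact: normr_ge0.
  have M1 : M * (M + 1)^-1 <= 1 by rewrite ler_pdivrMr ?mul1r ?lerDl// ltr_wpDl.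
  have mt' : `|m - t| <= (M + 1)^-1 / 2.
    rewrite distrC; apply: le_trans mt _; apply: le_trans (ltW ts) _.
    by rewrite ler_pM2r// ge_min lexx orbT.
  apply: le_trans (ler_wpM2l M0 mt') _; rewrite mulrA; lra.
have W0 : W m <= 0 by move: Wm; rewrite -subr_ge0; lra.
move=> i; have := le_trans (le_rV_norm _ i) (le_trans sW W0).
by rewrite normr_le0 !mxE subr_eq0 => /eqP.
Unshelve. all: by end_near. Qed.
End OrdinaryDifferentialEquations.

(** * Differential structures and charts *)

Section DifferentialStructures.
Context {R : realType} {T : topologicalType} {C : set (T -> R)}.
Hypothesis dsC : differential_structure C.

Lemma structure_continuous f : C f -> continuous f.
Proof.
move=> Cf x; apply/cvgrPdist_lt => e e0.
have [oB _] := ds_subbasis dsC.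
have /oB oI : finI_from
    [set A | exists f (a b : R), C f /\ A = f @^-1` `]a, b[%classic] id
    (f @^-1` `](f x - e), (f x + e)[).
  by apply: (@finI_from1 _ _ _ id); exists f, (f x - e), (f x + e).
have : nbhs x (f @^-1` `](f x - e), (f x + e)[%classic).
  apply: open_nbhs_nbhs; split=> //=.
  by rewrite in_itv/= ltrDl ltrBlDr ltrDl e0.
apply: filterS => y /=; rewrite in_itv/= => /andP[y1 y2].
by rewrite ltr_distlC y1 y2.
Qed.

(** The topology is the initial one for the functions of the structure. *)
Lemma cvg_structure (Y : Type) (F : set_system Y) (FF : Filter F)
    (u : Y -> T) p :
  (forall f, C f -> f (u y) @[y --> F] --> f p) -> u y @[y --> F] --> p.
Proof.
move=> fup A /(ds_subbasis dsC).2[B [[D' D'C BE] Bp] BA].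
suff : F (u @^-1` B) by apply: filterS => z; exact: BA.
rewrite -BE.
apply: (@filter_bigI _ _ D' (fun i => u @^-1` i)) => B' B'D'.
have := D'C _ B'D'; rewrite inE => -[f [a [b [Cf B'E]]]].
rewrite B'E; apply: fup => //.
have : (f @^-1` `]a, b[%classic) p.
  by rewrite -B'E; move: Bp; rewrite -BE; apply.
by move=> /= fp; apply: open_nbhs_nbhs; split => //; exact: interval_open.
Qed.

(** The coordinates of a chart are only defined on its domain U, but near y they
    agree with functions q_i of the global structure, to which a derivation
    applies; so a derivation never has to be restricted to U.  The smooth G
    comes from the inverse of the chart: f composed with it is smooth on a
    subset of R^n, hence extends near the image of y. *)
Lemma chart_coordinates (U : set T) y : open U -> U y ->
  euclidean_chart_domain C U ->
  exists n (q : 'I_n -> T -> R), [/\ forall i, C (q i),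
    exists2 W, nbhs y W & forall z z', W z -> W z' ->
      (forall i, q i z = q i z') -> z = z' &
    forall f, C f -> exists2 G, Cinfty 'rV[R]_n G &
      \forall z \near y, f z = G (\row_i q i z)].
Proof.
move=> oU Uy [n [A [phi [psi [phiK psiK [_ phiS] [_ psiS]]]]]].
pose y' : U := exist _ y (mem_set Uy).
have /choice[q qP] : forall i : 'I_n, exists q, C q /\
    \forall z \near y, forall Uz : z \in U,
      \val (phi (exist _ z Uz)) 0 i = q z.
  move=> i.
  have /phiS/(_ y')[V [q [[oV Vy] Cq Vq]]] :
    subspace_structure (Cinfty 'rV[R]_n) (A := A)
      (fun a : A => (\val a : 'rV[R]_n) 0 i).
    move=> a; exists setT, (fun r : 'rV[R]_n => r 0 i); split=> //.
      by split => //; exact: openT.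
    exact: Cinfty_coord.
  exists q; split=> //.
  have : nbhs y V by exact: open_nbhs_nbhs.
  by apply: filterS => z Vz Uz; exact: (Vq (exist _ z Uz)).
have Ny : \forall z \near y, z \in U /\ forall (Uz : z \in U),
    \val (phi (exist _ z Uz)) = \row_i q i z.
  apply: filterI.
    have : nbhs y U by exact: open_nbhs_nbhs.
    by apply: filterS => z Uz; exact: mem_set.
  have FF : Filter (nbhs y) by exact: nbhs_filter.
  have := @filter_forall _ 'I_n _ _ FF (fun i => (qP i).2).
  by apply: filterS => z H Uz; apply/rowP => i; rewrite H mxE.
exists n, q; split.
- by move=> i; case: (qP i).
- exists [set z | z \in U /\ forall (Uz : z \in U),
      \val (phi (exist _ z Uz)) = \row_i q i z]; first exact: Ny.
  move=> z z' [Uz Ez] [Uz' Ez'] qzz'.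
  have /(can_inj phiK)[//] : phi (exist _ z Uz) = phi (exist _ z' Uz').
  by apply: val_inj; rewrite Ez Ez'; apply/rowP => i; rewrite !mxE qzz'.
- move=> f Cf.
  have /psiS/(_ (phi y'))[V [G [[oV Vy] CG VG]]] :
      subspace_structure C (A := U) (fun u : U => f (\val u)).
    by move=> u; exists setT, f; split=> //; split=> //; exact: openT.
  exists G => //.
  have qy : (\row_i q i z : 'rV[R]_n) @[z --> y] --> (\row_i q i y : 'rV[R]_n).
    by apply: cvg_row => i; apply: structure_continuous; case: (qP i).
  have := nbhs_singleton Ny => -[_ Ey].
  have : nbhs (\row_i q i y : 'rV[R]_n) V.
    by apply: open_nbhs_nbhs; split=> //; rewrite -(Ey (mem_set Uy)).
  move=> /qy; rewrite nbhs_simpl/= => NV.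
  near=> z.
  have [Uz Ez] : z \in U /\ forall (Uz : z \in U),
    \val (phi (exist _ z Uz)) = \row_i q i z by near: z.
  have := VG (phi (exist _ z Uz)); rewrite Ez /= phiK /=; apply.
  by near: z.
Unshelve. all: by end_near. Qed.

End DifferentialStructures.

(** * Trajectories *)

Section Trajectories.
Context {R : realType} {T : topologicalType} {C : set (T -> R)}.
Variable X : (T -> R) -> (T -> R).

(** The counterpart of an integral curve for a total function on R of which only
    the restriction to D matters: curves with different domains can then be
    compared and united without coercions between subtypes.  Continuity of c
    along D is a consequence of [trj_smooth], by [trajectory_near]. *)
Record trajectory (D : set R) (c : R -> T) : Prop := {
  trj_interval : is_interval D;
  trj_smooth : forall f, C f -> forall t, D t ->
    exists2 g, Cinfty R^o g & \forall s \near t, D s -> f (c s) = g s;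
  trj_deriv : forall f, C f -> forall t, D t -> forall e, 0 < e ->
    \forall s \near t, D s ->
      `|f (c s) - f (c t) - (s - t) * X f (c t)| <= e * `|s - t| }.

Lemma trajectory_ext (D : set R) c c' :
  (forall s, D s -> c s = c' s) -> trajectory D c -> trajectory D c'.
Proof.
move=> cc' [iD sD dD]; split=> // f Cf t Dt.
  have [g Cg gE] := sD f Cf t Dt; exists g => //.
  by apply: filterS gE => s + Ds; rewrite -cc'//; apply.
move=> e e0; apply: filterS (dD f Cf t Dt e e0) => s + Ds.
by rewrite -!cc'//; apply.
Qed.

Lemma is_intervalI (D D' : set R) :
  is_interval D -> is_interval D' -> is_interval (D `&` D').
Proof.
move=> iD iD' x y [Dx D'x] [Dy D'y] z xyz.
by split; [exact: (iD x y)|exact: (iD' x y)].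
Qed.

Lemma interval_limit_point (D : set R) (t r : R) (P : R -> Prop) :
  is_interval D -> D t -> D r -> r != t -> (\forall s \near t, P s) ->
  exists s, [/\ D s, s != t & P s].
Proof.
move=> iD Dt Dr rt /nbhs_ballP[d /= d0 dP].
pose k := Num.min 1 (d / 2 / `|r - t|).
have rt0 : 0 < `|r - t| by rewrite normr_gt0 subr_eq0.
have k0 : 0 < k by rewrite lt_min ltr01 !divr_gt0.
have k1 : k <= 1 by rewrite ge_min lexx.
have kd : k * `|r - t| <= d / 2.
  by rewrite -ler_pdivlMr// ge_min lexx orbT.
exists (t + k * (r - t)); split.
- case: (ltP t r) => [tr|rt']; [apply: (iD t r)|apply: (iD r t)] => //; nra.
- by rewrite -subr_eq0 addrC addKr mulf_eq0 negb_or gt_eqF//= subr_eq0.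
- apply: dP; rewrite /ball/= opprD addrA subrr sub0r normrN normrM gtr0_norm//.
  by apply: le_lt_trans kd _; rewrite ltr_pdivrMr// ltr_pMr// ltr1n.
Qed.

(** The derivative of f o c along D determines that of any smooth extension g
    of f o c, even at an endpoint of D. *)
Lemma trajectory_derive1 D c f g t r : trajectory D c -> C f ->
  D t -> D r -> r != t -> Cinfty R^o g ->
  (\forall s \near t, D s -> f (c s) = g s) -> derive1 g t = X f (c t).
Proof.
move=> [iD sD dD] Cf Dt Dr rt Cg fg; apply/eqP; rewrite -subr_eq0 -normr_le0.
apply/ler_addgt0Pr => e e0; rewrite add0r.
have e2 : 0 < e / 2 by rewrite divr_gt0.
have /is_derive1P/(_ _ e2) dg := Cinfty_is_derive t Cg.
have df := dD f Cf t Dt _ e2.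
have fgt := nbhs_singleton fg Dt.
have [s [Ds st [H1 [H2 H3]]]] := interval_limit_point iD Dt Dr rt
  (filterI dg (filterI df fg)).
move: (H2 Ds); rewrite (H3 Ds) fgt => {}H2.
have st0 : 0 < `|s - t| by rewrite normr_gt0 subr_eq0.
rewrite -(ler_pM2l st0) -normrM.
rewrite (_ : (s - t) * _ = (g s - g t - (s - t) * X f (c t)) -
    (g s - g t - (s - t) * derive1 g t)); last by ring.
apply: le_trans (ler_normB _ _) _; apply: le_trans (lerD H2 H1) _.
by rewrite -mulrDl -splitr mulrC.
Qed.

(** As X f is again a function of the structure, the whole jet of a smooth
    extension of f o c at t is determined by the point c t. *)
Lemma trajectory_derive1n D c f g t r k : (forall f, C f -> C (X f)) ->
  trajectory D c -> C f -> D t -> D r -> r != t -> Cinfty R^o g ->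
  (\forall s \near t, D s -> f (c s) = g s) ->
  \forall s \near t, D s -> iter k X f (c s) = derive1n k g s.
Proof.
move=> CX tr Cf Dt Dr rt Cg fg; elim: k => [//|k IH].
have Ck : C (iter k X f) by elim: (k) => // j; exact: CX.
have := near_join IH; apply: filterS => s Hs Ds.
rewrite derive1nS; apply/esym.
have [u [Du us]] : exists u, D u /\ u != s.
  by have [<-|ts] := eqVneq t s; [exists r|exists t].
exact: (trajectory_derive1 tr Ck Ds Du us (Cinfty_derive1n k Cg) Hs).
Qed.

Hypothesis dsC : differential_structure C.

Lemma trajectory_near D c t (P : T -> Prop) : trajectory D c -> D t ->
  (\forall z \near c t, P z) -> \forall s \near t, D s -> P (c s).
Proof.
move=> [_ sD _] Dt.
suff : c s @[s --> within D (nbhs t)] --> c t by move=> + cP => /(_ _ cP).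
apply: (cvg_structure dsC) => f Cf; have [g Cg gE] := sD f Cf t Dt.
rewrite (nbhs_singleton gE Dt) => Q /(Cinfty_continuous Cg) gQ.
suff : \forall s \near t, D s -> Q (f (c s)) by [].
near=> s => Ds; rewrite (near gE s)//; near: s; exact: gQ.
Unshelve. all: by end_near. Qed.

Hypothesis CX : forall f, C f -> C (X f).

(** In the coordinates of a chart both curves solve the same ordinary
    differential equation near t, and the coordinates separate points. *)
Lemma trajectory_locally_unique (U : set T) D c D' c' t :
  open U -> U (c t) -> euclidean_chart_domain C U ->
  trajectory D c -> trajectory D' c' -> D t -> D' t -> c t = c' t ->
  \forall s \near t, D s -> D' s -> c s = c' s.
Proof.
move=> oU Uct chU tc tc' Dt D't cc't.
(* derivatives carry no information when t is the only common time *)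
have [[r [[Dr D'r] rt]]|K1] :=
  pselect (exists r, (D r /\ D' r) /\ r != t); last first.
  near=> s => Ds D's; have [->//|st] := eqVneq s t.
  by exfalso; apply: K1; exists s.
have [n [q [Cq [P nP q_inj] qG]]] := chart_coordinates dsC oU Uct chU.
have /choice[G GP] : forall i, exists G, Cinfty 'rV[R]_n G /\
    \forall z \near c t, X (q i) z = G (\row_i q i z).
  by move=> i; have [G] := qG _ (CX (Cq i)); exists G.
have /choice[u uP] : forall i, exists g, Cinfty R^o g /\
    \forall s \near t, D s -> q i (c s) = g s.
  by move=> i; have [g] := trj_smooth tc (Cq i) Dt; exists g.
have /choice[v vP] : forall i, exists g, Cinfty R^o g /\
    \forall s \near t, D' s -> q i (c' s) = g s.
  by move=> i; have [g] := trj_smooth tc' (Cq i) D't; exists g.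
have ode D0 c0 (w : 'I_n -> R -> R) :
    trajectory D0 c0 -> D0 t -> D0 r -> c0 t = c t ->
    (forall i, Cinfty R^o (w i) /\
      \forall s \near t, D0 s -> q i (c0 s) = w i s) ->
    \forall s \near t, D0 s ->
      (forall i, q i (c0 s) = w i s) /\
      (forall i, derive1 (w i) s = G i (\row_j w j s)).
  move=> tc0 D0t D0r c0t wP.
  have FF : Filter (nbhs t) by exact: nbhs_filter.
  have W := @filter_forall _ 'I_n _ _ FF (fun i => (wP i).2).
  have W1 := @filter_forall _ 'I_n _ _ FF (fun i =>
    trajectory_derive1n 1 CX tc0 (Cq i) D0t D0r rt (wP i).1 (wP i).2).
  have FT : Filter (nbhs (c t)) by exact: nbhs_filter.
  have GP2 := @filter_forall _ 'I_n _ _ FT (fun i => (GP i).2).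
  have Gc : \forall s \near t, D0 s ->
      forall i, X (q i) (c0 s) = G i (\row_j q j (c0 s)).
    apply: (@trajectory_near _ _ _
      (fun z => forall i, X (q i) z = G i (\row_j q j z)) tc0 D0t).
    by rewrite c0t; exact: GP2.
  near=> s => D0s; split=> [i|i]; first exact: (near W s).
  rewrite -derive1n1 -(near W1 s)//= (near Gc s)//; apply: congr1.
  by apply/rowP => j; rewrite !mxE; exact: (near W s).
have odeu := ode _ _ _ tc Dt Dr erefl uP.
have odev := ode _ _ _ tc' D't D'r (esym cc't) vP.
have uvt i : u i t = v i t.
  by rewrite -(nbhs_singleton (uP i).2 Dt) -(nbhs_singleton (vP i).2 D't) cc't.
have iK := is_intervalI (trj_interval tc) (trj_interval tc').
have uv : \forall s \near t, (D `&` D') s -> forall i, u i s = v i s.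
  have CG i : Cinfty 'rV[R]_n (G i) by case: (GP i).
  have du i (s : R) : is_derive s 1 (u i : R -> R^o) (derive1 (u i) s).
    by apply: Cinfty_is_derive; case: (uP i).
  have dv i (s : R) : is_derive s 1 (v i : R -> R^o) (derive1 (v i) s).
    by apply: Cinfty_is_derive; case: (vP i).
  apply: (ode_unique CG du dv iK (conj Dt D't) _ _ uvt).
  - by apply: filterS odeu => s + [Ds _] => /(_ Ds)[].
  - by apply: filterS odev => s + [_ D's] => /(_ D's)[].
have Pc := trajectory_near tc Dt nP.
have Pc' : \forall s \near t, D' s -> P (c' s).
  by apply: (trajectory_near tc' D't); rewrite -cc't.
have qu : \forall s \near t, D s -> forall i, q i (c s) = u i s.
  by apply: filterS odeu => s + Ds => /(_ Ds)[].
have qv : \forall s \near t, D' s -> forall i, q i (c' s) = v i s.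
  by apply: filterS odev => s + D's => /(_ D's)[].
near=> s => Ds D's; apply: q_inj.
- exact: (near Pc s).
- exact: (near Pc' s).
by move=> i; rewrite (near qu s)// (near qv s)//; exact: (near uv s).
Unshelve. all: by end_near. Qed.

(** The times at which the curves agree form a nonempty subset of the interval
    where both are defined; it is open there by local uniqueness, and closed
    there because two continuous maps to a Hausdorff space agree on a closed
    set. *)
Lemma trajectory_unique D c D' c' : hausdorff_space T ->
  (forall y, exists U : set T, [/\ open U, U y & euclidean_chart_domain C U]) ->
  trajectory D c -> trajectory D' c' -> D 0 -> D' 0 -> c 0 = c' 0 ->
  forall t, D t -> D' t -> c t = c' t.
Proof.
move=> hT charts tc tc' D0 D'0 c0.
pose K := D `&` D'; pose B := [set s | K s /\ c s = c' s].
have cK : connected K.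
  apply/connected_intervalP.
  exact: is_intervalI (trj_interval tc) (trj_interval tc').
suff BK : B = K by move=> t Dt D't; have [] : B t by rewrite BK.
apply: cK.
- by exists 0; do ?split.
- exists [set s | \forall r \near s, K r -> c r = c' r]^°.
    exact: open_interior.
  apply/seteqP; split=> [s [Ks cs]|s [Ks /interior_subset /nbhs_singleton H]].
    split=> //; apply/nbhs_interior.
    have [U [oU Us chU]] := charts (c s).
    have := trajectory_locally_unique oU Us chU tc tc' Ks.1 Ks.2 cs.
    by apply: filterS => r + [Dr D'r]; apply.
  by split=> //; exact: H.
- exists (closure B); first exact: closed_closure.
  apply/seteqP; split=> [s Bs|s [Ks cBs]].
    by split; [case: Bs|exact: subset_closure].
  split=> //; apply: hT => P Q nP nQ.
  have [r [[[Dr D'r] cr] [Pr Qr]]] := cBs _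
    (filterI (trajectory_near tc Ks.1 nP) (trajectory_near tc' Ks.2 nQ)).
  by exists (c r); split; [exact: Pr|rewrite cr; exact: Qr].
Qed.

(** All domains contain 0, so for t <> s in the union some member contains t
    and a point on the same side of t as s (s itself, or 0).  Near t, two members
    therefore cover the union, one on each side of t.  If they differ, each of
    them contains a time other than t, so the local smooth extensions of f o c
    that they provide have the same jet at t, and their splice is smooth. *)
Lemma trajectory_bigcup (F : set (set R)) c :
  (forall D, F D -> D 0 /\ trajectory D c) ->
  trajectory (\bigcup_(D in F) D) c.
Proof.
move=> FP; set I := \bigcup_(D in F) D.
have iF D : F D -> forall s r z, D s -> D r -> s <= z <= r -> D z.
  by move=> FD s r z Ds Dr; have [_ tD] := FP _ FD; exact: (trj_interval tD).
have side t r : I t -> I r -> exists D r',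
    [/\ F D, D t, D r', r < t -> r' < t & t < r -> t < r'].
  move=> [D FD Dt] [D' FD' D'r].
  have [D0 _] := FP _ FD; have [D'0 _] := FP _ FD'.
  have [D't|D't] := pselect (D' t); first by exists D', r.
  have [Dr|Dr] := pselect (D r); first by exists D, r.
  exists D, 0; split=> // rt.
  - rewrite ltNge; apply/negP => t0; apply: D't.
    by apply: (iF _ FD' r 0) => //; rewrite ltW.
  - rewrite ltNge; apply/negP => t0; apply: D't.
    by apply: (iF _ FD' 0 r) => //; rewrite t0 ltW.
have iI : is_interval I.
  move=> x y [D FD Dx] [D' FD' D'y] z /andP[xz zy].
  have [z0|/ltW z0] := leP z 0.
    by exists D => //; apply: (iF _ FD x 0) => //; [case: (FP _ FD)|rewrite xz].
  exists D' => //; apply: (iF _ FD' 0 y) => //; first by case: (FP _ FD').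
  by rewrite z0.
(* the alternative D1 = D2 is for endpoints of I, where one side is trivial *)
have cover t : I t -> exists D1 D2, [/\ F D1, F D2, D1 t, D2 t &
  [/\ (\forall s \near t, I s -> s <= t -> D1 s),
      (\forall s \near t, I s -> t <= s -> D2 s) &
      D1 = D2 \/ (exists2 r, D1 r & r != t) /\ (exists2 r, D2 r & r != t)]].
  move=> It.
  have left r : I r -> r < t -> exists D, [/\ F D, D t,
      (\forall s \near t, I s -> s <= t -> D s) & exists2 r, D r & r != t].
    move=> Ir rt; have [D [r' [FD Dt Dr' + _]]] := side t r It Ir.
    move=> /(_ rt) r't; exists D; split=> //.
      near=> s => _ st; apply: (iF _ FD r' t) => //; rewrite st andbT ltW//.
      by near: s; exact: lt_nbhsr.
    by exists r' => //; rewrite lt_eqF.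
  have right r : I r -> t < r -> exists D, [/\ F D, D t,
      (\forall s \near t, I s -> t <= s -> D s) & exists2 r, D r & r != t].
    move=> Ir rt; have [D [r' [FD Dt Dr' _]]] := side t r It Ir.
    move=> /(_ rt) r't; exists D; split=> //.
      near=> s => _ st; apply: (iF _ FD t r') => //; rewrite st ltW//.
      by near: s; exact: lt_nbhsl.
    by exists r' => //; rewrite gt_eqF.
  have [[r Ir rt]|noleft] := pselect (exists2 r, I r & r < t);
      have [[r' Ir' rt']|noright] := pselect (exists2 r, I r & t < r).
  - have [D1 [FD1 D1t n1 e1]] := left r Ir rt.
    have [D2 [FD2 D2t n2 e2]] := right r' Ir' rt'.
    by exists D1, D2; split=> //; split=> //; right.
  - have [D1 [FD1 D1t n1 e1]] := left r Ir rt.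
    exists D1, D1; split=> //; split=> //; last by left.
    near=> s => Is ts; have [<-//|st] := eqVneq t s.
    by exfalso; apply: noright; exists s => //; rewrite lt_neqAle st.
  - have [D1 [FD1 D1t n1 e1]] := right r' Ir' rt'.
    exists D1, D1; split=> //; split=> //; last by left.
    near=> s => Is ts; have [->//|st] := eqVneq s t.
    by exfalso; apply: noleft; exists s => //; rewrite lt_neqAle st.
  - case: It => D FD Dt; exists D, D; split=> //; split=> //; last by left.
      near=> s => Is ts; have [->//|st] := eqVneq s t.
      by exfalso; apply: noleft; exists s => //; rewrite lt_neqAle st.
    near=> s => Is ts; have [<-//|st] := eqVneq t s.
    by exfalso; apply: noright; exists s => //; rewrite lt_neqAle st.
split=> // f Cf t It.
  have [D1 [D2 [FD1 FD2 D1t D2t [n1 n2 e12]]]] := cover t It.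
  have [_ t1] := FP _ FD1; have [_ t2] := FP _ FD2.
  have [g1 Cg1 gE1] := trj_smooth t1 Cf D1t.
  case: e12 => [E|[[r1 D1r1 r1t] [r2 D2r2 r2t]]].
    exists g1 => //; near=> s => Is; apply: (near gE1 s) => //.
    case: (leP s t) => [|/ltW] st; first by apply: (near n1 s).
    by rewrite E; apply: (near n2 s).
  have [g2 Cg2 gE2] := trj_smooth t2 Cf D2t.
  exists (splice t g1 g2).
    move=> k; apply: Ck_splice => // j.
    have J1 := trajectory_derive1n j CX t1 Cf D1t D1r1 r1t Cg1 gE1.
    have J2 := trajectory_derive1n j CX t2 Cf D2t D2r2 r2t Cg2 gE2.
    by rewrite -(nbhs_singleton J1 D1t) -(nbhs_singleton J2 D2t).
  near=> s => Is; rewrite /splice; case: (leP s t) => [|/ltW] st.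
    by rewrite (near gE1 s)//; apply: (near n1 s).
  by rewrite (near gE2 s)//; apply: (near n2 s).
move=> e e0; have [D1 [D2 [FD1 FD2 D1t D2t [n1 n2 _]]]] := cover t It.
have [_ t1] := FP _ FD1; have [_ t2] := FP _ FD2.
have d1 := trj_deriv t1 Cf D1t e0; have d2 := trj_deriv t2 Cf D2t e0.
near=> s => Is; case: (leP s t) => [|/ltW] st.
  by apply: (near d1 s) => //; apply: (near n1 s).
by apply: (near d2 s) => //; apply: (near n2 s).
Unshelve. all: by end_near. Qed.

End Trajectories.

(** * Integral curves *)

Section IntegralCurves.
Context {R : realType} {T : topologicalType} {C : set (T -> R)}.
Variables (X : (T -> R) -> (T -> R)) (x : T).

Lemma nbhs_subtypeP (Y : topologicalType) (A : set Y) (t : A) (P : set A) :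
  nbhs t P <-> exists2 V, nbhs (\val t) V & forall s : A, V (\val s) -> P s.
Proof.
split=> [[_ [[V oV <-] Vt VP]]|[V]].
  by exists V => [|s]; [exact: open_nbhs_nbhs|exact: VP].
move=> Vt VP; apply: filterS VP _.
exact: (@initial_continuous A Y set_val t _ Vt).
Qed.

Lemma dom_val (D : set R) (t : D) : D (\val t).
Proof. by case: t => t /= /set_mem. Qed.

Definition extension (c : curve R T) (s : R) : T :=
  if pselect (dom c s) is left h then c (exist _ s (mem_set h)) else x.

Lemma extensionE (c : curve R T) (t : dom c) : extension c (\val t) = c t.
Proof.
rewrite /extension; case: pselect => [h|]; first by congr (c _); exact: val_inj.
by move=> /(_ (dom_val t)).
Qed.

Definition restriction (D : set R) (c : R -> T) : curve R T :=
  Curve (fun t : D => c (\val t)).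

Lemma curve_ext (c d : curve R T) : dom c = dom d ->
  (forall s, dom c s -> extension c s = extension d s) -> c = d.
Proof.
case: c d => [D c] [D' d] /= E; subst D' => cd; congr Curve.
apply/funext => t.
have := cd (\val t) (dom_val t).
by rewrite (extensionE (c := Curve c)) (extensionE (c := Curve d)).
Qed.

Lemma integral_curve_trajectory c : integral_curve C X x c ->
  [/\ dom c 0, extension c 0 = x & trajectory (C := C) X (dom c) (extension c)].
Proof.
move=> [iD D0 [_ sD] c0 dD]; split=> //.
  by rewrite -[0]/(\val (exist _ 0 (mem_set D0) : dom c)) extensionE c0.
split=> // f Cf t Dt.
  have [U [g [oU Cg Ug]]] := sD f Cf (exist _ t (mem_set Dt)).
  exists g => //; have : nbhs t U by exact: open_nbhs_nbhs.
  apply: filterS => s Us Ds.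
  by rewrite -[s]/(\val (exist _ s (mem_set Ds) : dom c)) extensionE -Ug.
move=> e e0; pose t' : dom c := exist _ t (mem_set Dt).
have /cvgrPdist_le/(_ e e0) := dD f Cf t'.
move=> /nbhs_subtypeP[V /= Vt VP]; apply: filterS Vt => s Vs Ds.
have [->|st] := eqVneq s t; first by rewrite !subrr mul0r subrr normr0 mulr0.
pose s' : dom c := exist _ s (mem_set Ds).
have s't' : s' != t' by rewrite -(inj_eq val_inj).
have := VP s' Vs s't'; rewrite -!extensionE /=.
have st0 : s - t != 0 by rewrite subr_eq0.
move=> /(ler_wpM2l (normr_ge0 (s - t))).
rewrite -normrM mulrBr mulrCA mulfV// mulr1.
by rewrite [leLHS]distrC [leRHS]mulrC.
Qed.

Hypothesis dsC : differential_structure C.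

Lemma trajectory_integral_curve D c : D 0 -> c 0 = x ->
  trajectory (C := C) X D c -> integral_curve C X x (restriction D c).
Proof.
move=> D0 c0 tc; have [iD sD dD] := tc; split=> //=.
- split.
    move=> t P /= cP.
    apply/nbhs_subtypeP; exists [set s | D s -> P (c s)].
      exact: (trajectory_near dsC tc (dom_val t) cP).
    by move=> s; apply; exact: dom_val.
  move=> f Cf t; have [g Cg gE] := sD f Cf _ (dom_val t).
  move: gE; rewrite /prop_near1 nbhsE => -[U oU UE].
  by exists U, g; split=> // y Uy; exact: UE Uy (dom_val y).
- by move=> t t0; rewrite t0.
- move=> f Cf t; apply/cvgrPdist_le => e e0.
  apply/nbhs_subtypeP; eexists; first exact: (dD f Cf _ (dom_val t) e e0).
  move=> s /(_ (dom_val s)) H st.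
  have st0 : \val s - \val t != 0 by rewrite subr_eq0 (inj_eq val_inj).
  have st1 : 0 < `|\val s - \val t| by rewrite normr_gt0.
  rewrite -(ler_pM2l st1) -normrM mulrBr mulrCA mulfV// mulr1.
  by rewrite [leLHS]distrC [leRHS]mulrC.
Qed.

Lemma integral_curve_point :
  integral_curve C X x (restriction [set 0] (fun=> x)).
Proof.
apply: trajectory_integral_curve => //; split.
- move=> s r -> -> z; rewrite -eq_le => /eqP<- //.
- by move=> f Cf t _; exists (fun=> f x); [move=> k; exact: Ck_cst|near=> s].
- move=> f Cf t -> e e0; near=> s => ->.
  by rewrite !subrr mul0r subrr normr0 mulr0.
Unshelve. all: by end_near. Qed.

End IntegralCurves.

Theorem theorem1 (R : realType) (S : topologicalType) (CS : set (S -> R))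
    (hS : subcartesian CS) (x : S) (X : (S -> R) -> (S -> R))
    (hX : derivation CS X) :
  exists! c : curve R S, maximal_integral_curve CS X x c.
Proof.
have [[dsC hT _ _] [Us [oUs cUs] chUs]] := hS.
have CX := der_stable hX.
have charts y :
    exists U : set S, [/\ open U, U y & euclidean_chart_domain CS U].
  have : [set: S] y by [].
  rewrite -cUs => -[U UsU Uy]; exists U; split=> //; [exact: oUs|exact: chUs].
pose F : set (set R) :=
  [set D | exists2 c, integral_curve CS X x c & dom c = D].
pose I := \bigcup_(D in F) D.
(* w t is the common position at time t of the integral curves through x *)
have /choice[w wP] : forall t, exists p, forall c,
    integral_curve CS X x c -> dom c t -> extension x c t = p.
  move=> t; have [[c ic ct]|N] :=
    pselect (exists2 c, integral_curve CS X x c & dom c t); last first.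
    by exists x => c ic ct; exfalso; apply: N; exists c.
  exists (extension x c t) => d id dt.
  have [c0 cx tc] := integral_curve_trajectory ic.
  have [d0 dx td] := integral_curve_trajectory id.
  by apply: (trajectory_unique dsC CX hT charts td tc) => //; rewrite cx.
have FP D : F D -> D 0 /\ trajectory (C := CS) X D w.
  move=> [c ic <-]; have [c0 cx tc] := integral_curve_trajectory ic.
  by split=> //; apply: trajectory_ext tc => s; exact: wP.
pose m := restriction I w.
have mI (c : curve R S) : integral_curve CS X x c -> dom c `<=` dom m.
  by move=> ic t ct; exists (dom c) => //; exists c.
have mE s : I s -> extension x m s = w s.
  move=> Is; by rewrite -[s]/(\val (exist _ s (mem_set Is) : dom m)) extensionE.
have im : integral_curve CS X x m.
  have I0 : I 0.
    exists [set 0] => //; exists (restriction [set 0] (fun=> x)) => //.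
    exact: integral_curve_point.
  apply: trajectory_integral_curve => //; last exact: trajectory_bigcup FP.
  have [c0 cx _] := integral_curve_trajectory (integral_curve_point X x dsC).
  by rewrite -(wP _ _ (integral_curve_point X x dsC) c0).
exists m; split.
  split=> // -[d id [[_ nsub] _]]; apply: nsub; exact: mI.
move=> c [ic cmax].
have E : dom c = dom m.
  apply/seteqP; split; first exact: mI.
  apply: contrapT => nsub; apply: cmax; exists m => //; split.
    by split => //; exact: mI.
  move=> s t st; rewrite -!(extensionE x) (wP _ c)//; last exact: dom_val.
  by rewrite mE ?st//; exact: dom_val.
apply: (@curve_ext _ _ x) => // s; rewrite -E => cs.
by rewrite (wP _ c)// mE//; exact: mI ic _ cs.
Qed.
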